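(* Let $K$ be a number field of degree $n=[K:\mathbb Q]$ with ring of integers $\mathcal O_K$. There exist constants $B,\alpha>0$ depending only on $n$ such that, for every (nonzero) prime ideal $\mathfrak p$ of $\mathcal O_K$, every integer $e\ge1$, and every subgroup $H\subset \mathrm{SL}_2(\mathcal O_K/\mathfrak p^e)$ of exact level $e$, one has $$\frac{\big|H\backslash \mathrm{SL}_2(\mathcal O_K/\mathfrak p^e)/U_e\big|}{[\mathrm{SL}_2(\mathcal O_K/\mathfrak p^e):H]}\ \le\ |\mathcal O_K/\mathfrak p|^{\,B-\alpha e},$$ where $U_e$ denotes the subgroup of upper triangular unipotent matrices $\begin{pmatrix}1&x\\0&1\end{pmatrix}$, $x\in\mathcal O_K/\mathfrak p^e$.
   Context: For $j\le k$ let $\rho_{k,j}:\mathrm{SL}_2(\mathcal O_K/\mathfrak p^k)\to \mathrm{SL}_2(\mathcal O_K/\mathfrak p^j)$ be the reduction map. A subgroup $H\subset \mathrm{SL}_2(\mathcal O_K/\mathfrak p^e)$ has exact level $e$ if $H\ne\rho_{e,e-1}^{-1}(\rho_{e,e-1}(H))$ when $e>1$, and if $H\neq \mathrm{SL}_2(\mathcal O_K/\mathfrak p)$ when $e=1$. *)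

(* Defs.v *)
From HB Require Import structures.
From mathcomp Require Import all_boot all_order all_fingroup all_algebra all_field.
From mathcomp Require Import generic_quotient ring_quotient boolp reals exp.

Set Implicit Arguments.
Unset Strict Implicit.
Unset Printing Implicit Defensive.

Import Order.TTheory GRing.Theory Num.Theory.
Local Open Scope ring_scope.
Local Open Scope quotient_scope.

Definition algebraic_integers (K : fieldExtType rat) : {pred K} :=
  fun x => `[< integralOver (intr : int -> K) x >].
Arguments algebraic_integers K _ : clear implicits.

Lemma algebraic_integersP (K : fieldExtType rat) (x : K) :
  reflect (integralOver (intr : int -> K) x) (x \in algebraic_integers K).
Proof. exact: asboolP. Qed.

Lemma algebraic_integers_subring (K : fieldExtType rat) :
  subring_closed (algebraic_integers K).
Proof.
split=> [|x y|x y]; rewrite -!(rwP (algebraic_integersP _)).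
- exact: (integral1 (intr : {rmorphism int -> K})).
- exact: (@integral_sub _ _ (intr : {rmorphism int -> K})).
- exact: (@integral_mul _ _ (intr : {rmorphism int -> K})).
Qed.

HB.instance Definition _ (K : fieldExtType rat) :=
  GRing.isSubringClosed.Build K (algebraic_integers K)
    (@algebraic_integers_subring K).

Record ring_of_integers (K : fieldExtType rat) := RingOfIntegers {
  int_val :> K;
  int_valP : int_val \in algebraic_integers K
}.

Section RingOfIntegersInstances.
Variable K : fieldExtType rat.
HB.instance Definition _ := [isSub for @int_val K].
HB.instance Definition _ := [Choice of ring_of_integers K by <:].
HB.instance Definition _ :=
  [SubChoice_isSubComNzRing of ring_of_integers K by <:].
End RingOfIntegersInstances.

Notation "''O_' K" := (ring_of_integers K)
  (at level 8, K at level 2, format "''O_' K") : type_scope.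

(* The library's [idealr] and [prime_idealr] are proper ideals; a nonzero
   element is required separately. *)
HB.mixin Record isNonzeroIdeal (R : nzRingType) (S : R -> bool) := {
  nonzero_ideal_subproof : exists2 x, x \in S & x != 0
}.

#[short(type="nz_idealr")]
HB.structure Definition NzIdealr (R : nzRingType) :=
  {S of Idealr R S & isNonzeroIdeal R S}.

#[short(type="nz_prime_idealr")]
HB.structure Definition NzPrimeIdealr (R : nzRingType) :=
  {S of PrimeIdealr R S & isNonzeroIdeal R S}.

Definition ideal_mul (R : comNzRingType) (I J : {pred R}) : {pred R} :=
  fun x => `[< exists m (a b : 'I_m -> R),
    [/\ forall i, a i \in I, forall i, b i \in J & x = \sum_i a i * b i] >].

(* [ideal_exp I 0] is the unit ideal; only the positive powers are proper, hence
   instances of [idealr]. *)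
Definition ideal_exp (R : comNzRingType) (I : {pred R}) (k : nat) : {pred R} :=
  iter k (ideal_mul I) predT.

Section IdealExp.
Variable R : comNzRingType.
Implicit Type I : idealr R.

Lemma ideal_exp_closed I k :
  [/\ 0 \in ideal_exp I k
    & forall a, {in ideal_exp I k &, forall u v, a * u + v \in ideal_exp I k}].
Proof.
case: k => [|k]; first by split.
split=> [|a u v /asboolP[m [x [y [xI yJ ->]]]] /asboolP[l [z [t [zI tJ ->]]]]].
  by apply/asboolP; exists 0, (fun=> 0), (fun=> 0); split=> [[]|[]|] //; rewrite big_ord0.
pose cat (f : 'I_m -> R) (g : 'I_l -> R) (i : 'I_(m + l)) :=
  match split i with inl j => f j | inr j => g j end.
apply/asboolP; exists (m + l)%N, (cat (fun i => a * x i) z), (cat y t).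
split=> [i|i|]; rewrite /cat; try by case: split => j //; apply: idealMr.
rewrite big_split_ord mulr_sumr; congr (_ + _); apply: eq_bigr => i _.
  by rewrite (unsplitK (inl i)) mulrA.
by rewrite (unsplitK (inr i)).
Qed.

Lemma ideal_expS_sub I k : {subset ideal_exp I k.+1 <= ideal_exp I k}.
Proof.
move=> x /asboolP[m [a [b [_ bJ ->]]]].
have [J0 JD] := ideal_exp_closed I k.
elim/big_ind: _ => // [u v uJ vJ|i _]; first by rewrite -[u]mul1r JD.
by rewrite -[_ * _]addr0 JD.
Qed.

Lemma ideal_exp_sub I j k :
  (j <= k)%N -> {subset ideal_exp I k <= ideal_exp I j}.
Proof.
move=> /subnK <-; elim: (k - j)%N => // d IHd x.
by rewrite addSn => /ideal_expS_sub/IHd.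
Qed.

Lemma ideal_exp1E I : ideal_exp I 1 =i I.
Proof.
move=> x; apply/idP/idP => [/asboolP[m [a [b [aI _ ->]]]]|xI].
  by apply: rpred_sum => i _; rewrite mulrC idealMr.
apply/asboolP; exists 1, (fun=> x), (fun=> 1).
by split=> //; rewrite big_ord_recl big_ord0 addr0 mulr1.
Qed.

Lemma ideal_expS_idealr_closed I k : idealr_closed (ideal_exp I k.+1).
Proof.
have [J0 JD] := ideal_exp_closed I k.+1; split=> //.
by apply/negP => /(@ideal_exp_sub I 1 k.+1 isT); rewrite ideal_exp1E idealr1.
Qed.

HB.instance Definition _ I k :=
  isIdealr.Build R (ideal_exp I k.+1) (ideal_expS_idealr_closed I k).

End IdealExp.

Lemma int_val_eq0 (K : fieldExtType rat) (x : 'O_K) : (val x == 0) = (x == 0).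
Proof. by rewrite -(inj_eq val_inj) rmorph0. Qed.

Lemma int_mul_eq0 (K : fieldExtType rat) (x y : 'O_K) :
  (x * y == 0) = (x == 0) || (y == 0).
Proof. by rewrite -!int_val_eq0 -mulf_eq0. Qed.

Lemma ideal_expS_nonzero (K : fieldExtType rat) (I : nz_idealr 'O_K) k :
  exists2 x, x \in ideal_exp I k.+1 & x != 0.
Proof.
have [x xI nzx] := nonzero_ideal_subproof (s := I).
exists (x ^+ k.+1); last by rewrite -int_val_eq0 rmorphXn expf_neq0 ?int_val_eq0.
elim: k.+1 => // d IHd; apply/asboolP; exists 1, (fun=> x), (fun=> x ^+ d).
by split=> //; rewrite big_ord_recl big_ord0 addr0 exprS.
Qed.

HB.instance Definition _ (K : fieldExtType rat) (I : nz_idealr 'O_K) k :=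
  isNonzeroIdeal.Build 'O_K (ideal_exp I k.+1) (ideal_expS_nonzero I k).

Section ResidueFinite.
Variable K : fieldExtType rat.
Implicit Type I : nz_idealr 'O_K.

Lemma nz_ideal_nat I : exists N : nat, (N.+1%:R : 'O_K) \in I.
Proof.
have [x xI nzx] := nonzero_ideal_subproof (s := I).
have [p mon_p] := algebraic_integersP _ (valP x).
have -> : map_poly intr p = map_poly val (map_poly (intr : int -> 'O_K) p).
  by rewrite -map_poly_comp; apply: eq_map_poly => i; exact/esym/rmorph_int.
rewrite /root horner_map int_val_eq0 => px0.
suff [c nzc cI] : exists2 c : int, c != 0 & (c%:~R : 'O_K) \in I.
  case: c nzc cI => [[|m]|m] // _ cI; exists m => //.
  by rewrite NegzE mulrNz rpredN in cI.
move/monic_neq0: mon_p px0; elim/poly_ind: p => [|p c IHp]; first by rewrite eqxx.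
rewrite rmorphD rmorphM /= map_polyX map_polyC /= !hornerE.
have [-> | nzc] := eqVneq c 0.
  rewrite !addr0 int_mul_eq0 (negPf nzx) orbF.
  by move=> nzpX; apply: IHp; apply: contraNneq nzpX => ->; rewrite mul0r.
move=> _; rewrite addrC addr_eq0 => /eqP Dc.
by exists c => //; rewrite Dc rpredN idealMr.
Qed.

Lemma residue_inj_bound I :
  exists M, forall f : 'I_M.+1 -> {ideal_quot I}, ~ injective f.
Proof.
have [N NI] := nz_ideal_nat I; pose d := \dim {:K}.
exists #|{: {ffun 'I_d -> 'I_N.+1}}| => f inj_f; set M := #|_| in f inj_f.
pose x i : 'O_K := repr (f i).
pose X := \matrix_(i < M.+1, j < d) coord (vbasis {:K}) j (val (x i)).
have [D nzD [Z DZ]] : exists2 D : int, D != 0 &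
    exists Z : 'M[int]_(M.+1, d), D%:~R *: X = map_mx intr Z.
  exists (\prod_(u : 'I_M.+1 * 'I_d) denq (X u.1 u.2)).
    by rewrite prodf_seq_neq0; apply/allP=> u _; rewrite denq_neq0.
  exists (\matrix_(i, j)
    (numq (X i j) * \prod_(u : 'I_M.+1 * 'I_d | u != (i, j)) denq (X u.1 u.2))).
  apply/matrixP=> i j; rewrite mxE [RHS]mxE [in RHS]mxE (bigD1 (i, j)) //=.
  rewrite !intrM numqE.
  by rewrite mulrC mulrA.
have [L uL [Q _ [s _ DLQ]]] := int_Smith_normal_form Z.
pose z j : 'O_K := \sum_k x k *~ invmx L j k.
have Dx i : x i = \sum_j z j *~ L i j.
  under eq_bigr => j _ do
    (rewrite /z mulrz_suml; under eq_bigr => k _ do rewrite -mulrzA mulrC).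
  rewrite exchange_big (bigD1 i) //= -mulrz_sumr.
  have LK k : \sum_j L i j * invmx L j k = (i == k)%:R.
    by have /matrixP/(_ i k) := mulmxV uL; rewrite !mxE.
  rewrite LK eqxx mulr1z big1 ?addr0 // => k /negPf ne_ki.
  by rewrite -mulrz_sumr LK eq_sym ne_ki mulr0z.
have z0 (j : 'I_M.+1) : (d <= j)%N -> z j = 0.
  move=> le_dj; apply/eqP; rewrite -int_val_eq0; apply/eqP.
  rewrite [LHS](coord_vbasis (memvf _)) big1 // => l _.
  suff -> : coord (vbasis {:K}) l (val (z j)) = 0 by rewrite scale0r.
  have nzDr : D%:~R != 0 :> rat by rewrite intr_eq0.
  apply: (mulfI nzDr); rewrite mulr0 raddf_sum linear_sum mulr_sumr.
  transitivity (((invmx L *m Z) j l)%:~R : rat).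
    rewrite mxE rmorph_sum; apply: eq_bigr => k _.
    move/matrixP/(_ k l): DZ; rewrite !mxE rmorphM /= => <-.
    have -> : int_val (x k *~ invmx L j k) = (invmx L j k)%:~R *: int_val (x k).
      by rewrite scaler_int; apply: (raddfMz val).
    by rewrite linearZ mulrCA.
  rewrite DLQ -mulmxA mulKmx // mxE big1 // => i _.
  by rewrite mxE gtn_eqF ?mul0r // (leq_trans (ltn_ord i)).
pose g i : {ffun 'I_d -> 'I_N.+1} := [ffun j : 'I_d =>
   inord `|(L i (inord j) %% N.+1)%Z|].
have [i [k [neq_ik eq_g]]] : exists i, exists k, i != k /\ g i = g k.
  apply: contrapT => no_ik; suff /leq_card : injective g.
    by rewrite card_ord ltnn.
  move=> i k eq_g; have [// | ne_ik] := eqVneq i k.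
  by case: no_ik; exists i, k.
case/eqP: neq_ik; apply: inj_f.
rewrite -[f i]reprK -[f k]reprK; apply/eqP; rewrite -Quotient.idealrBE.
rewrite -/(x i) -/(x k) !Dx -sumrB; apply: rpred_sum => j _.
rewrite -mulrzBr.
have [/z0 -> | lt_jd] := leqP d j; first by rewrite mul0rz rpred0.
have /ffunP/(_ (Ordinal lt_jd)) := eq_g; rewrite !ffunE inord_val.
have lt_mod (c : int) : (`|(c %% N.+1)%Z| < N.+1)%N.
  by rewrite -ltz_nat gez0_abs ?modz_ge0 ?ltz_pmod.
move/(congr1 (@nat_of_ord _)); rewrite !inordK ?lt_mod // => /(congr1 Posz).
rewrite !gez0_abs ?modz_ge0 // => /eqP; rewrite eqz_mod_dvd => /dvdzP[q ->].
by rewrite mulrzA -[_ *~ Posz _]mulr_natr idealMr.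
Qed.

Lemma residue_enum I : exists s : seq {ideal_quot I}, uniq s /\ forall x, x \in s.
Proof.
have [M noM] := residue_inj_bound I.
pose P m := `[< exists s : seq {ideal_quot I}, uniq s /\ size s = m >].
have P0 : exists m, P m by exists 0; apply/asboolP; exists [::].
have PM m : P m -> (m <= M)%N.
  move=> /asboolP[s [s_uniq <-]]; rewrite leqNgt; apply/negP=> ltMs.
  have [x0 _] : exists x0, x0 \in s by case: s ltMs {s_uniq} => // x0 s; exists x0; rewrite inE eqxx.
  apply: (noM (fun i => nth x0 s i)) => i j /eqP; rewrite nth_uniq ?(leq_trans (ltn_ord _)) //.
  by move/eqP/val_inj.
case: (ex_maxnP P0 PM) => m /asboolP[s [s_uniq sz_s]] max_s.
exists s; split=> // x; apply: contraT => s'x.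
have /max_s : P m.+1 by apply/asboolP; exists (x :: s); rewrite /= s'x sz_s.
by rewrite ltnn.
Qed.

Let enum I : seq {ideal_quot I} := projT1 (cid (residue_enum I)).

Let enumT I x : x \in enum I.
Proof. by rewrite /enum; case: cid => s []. Qed.

Let enum_axiom I : Finite.axiom (enum I).
Proof.
by apply: Finite.uniq_enumP => [|x]; [rewrite /enum; case: cid => s [] | rewrite enumT].
Qed.

Let enumK I : pcancel (index^~ (enum I)) (nth None (map some (enum I))).
Proof. by move=> x; rewrite (nth_map x) ?nth_index ?index_mem ?enumT. Qed.

HB.instance Definition _ I :=
  Choice_isCountable.Build {ideal_quot I} (@enumK I).
HB.instance Definition _ I := isFinite.Build {ideal_quot I} (@enum_axiom I).

End ResidueFinite.

Record SL2 (R : comNzRingType) := MkSL2 {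
  SL2_val :> 'M[R]_2;
  SL2_valP : \det SL2_val == 1
}.

HB.instance Definition _ (R : comNzRingType) := [isSub for @SL2_val R].
HB.instance Definition _ (R : comNzRingType) := [Choice of SL2 R by <:].
HB.instance Definition _ (R : finComNzRingType) := [Finite of SL2 R by <:].

Section SL2Group.
Variable R : finComNzRingType.

Lemma SL2_det (A : SL2 R) : \det A = 1. Proof. exact/eqP/SL2_valP. Qed.

Fact SL2_mul_subproof (A B : SL2 R) : \det (A *m B) == 1.
Proof. by rewrite det_mulmx !SL2_det mulr1. Qed.
Fact SL2_one_subproof : \det (1%:M : 'M[R]_2) == 1.
Proof. by rewrite det1. Qed.
Fact SL2_inv_subproof (A : SL2 R) : \det (\adj A) == 1.
Proof.
have /(congr1 determinant) := mul_mx_adj A.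
by rewrite det_mulmx SL2_det mul1r det1 => ->.
Qed.

Definition SL2_mul A B := MkSL2 (SL2_mul_subproof A B).
Definition SL2_one := MkSL2 SL2_one_subproof.
Definition SL2_inv A := MkSL2 (SL2_inv_subproof A).

Fact SL2_mulA : associative SL2_mul.
Proof. by move=> A B C; apply: val_inj; rewrite /= mulmxA. Qed.
Fact SL2_mul1 : left_id SL2_one SL2_mul.
Proof. by move=> A; apply: val_inj; rewrite /= mul1mx. Qed.
Fact SL2_mulV : left_inverse SL2_one SL2_inv SL2_mul.
Proof. by move=> A; apply: val_inj; rewrite /= mul_adj_mx SL2_det. Qed.

HB.instance Definition _ :=
  Finite_isGroup.Build (SL2 R) SL2_mulA SL2_mul1 SL2_mulV.

Fact unip_subproof (x : R) :
  \det (block_mx 1%:M x%:M 0 1%:M : 'M_(1 + 1)) == 1.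
Proof. by rewrite det_ublock !det1 mulr1. Qed.

Definition unip (x : R) : SL2 R := MkSL2 (unip_subproof x).

Definition unipotent : {set SL2 R} := [set unip x | x : R].

Lemma unipotent_group_set : group_set unipotent.
Proof.
apply/group_setP; split=> [|_ _ /imsetP[x _ ->] /imsetP[y _ ->]].
  apply/imsetP; exists 0 => //; apply: val_inj => /=.
  by rewrite raddf0 -scalar_mx_block.
apply/imsetP; exists (x + y) => //; apply: val_inj.
rewrite -[LHS]/((block_mx 1%:M x%:M 0 1%:M : 'M[R]_(1 + 1)) *m block_mx 1%:M y%:M 0 1%:M).
rewrite mulmx_block !mulmx0 !mul0mx !mul1mx !mulmx1 !addr0 ?add0r.
by rewrite addrC -raddfD.
Qed.

Canonical unipotent_group := Group unipotent_group_set.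

End SL2Group.

Section SL2Map.
Variables (R S : comNzRingType) (f : {rmorphism R -> S}).

Fact SL2_map_subproof (A : SL2 R) : \det (map_mx f A) == 1.
Proof. by rewrite det_map_mx (eqP (SL2_valP A)) rmorph1. Qed.

Definition SL2_map (A : SL2 R) : SL2 S := MkSL2 (SL2_map_subproof A).

End SL2Map.

Definition double_cosets (gT : finGroupType) (H U : {set gT}) : {set {set gT}} :=
  [set ((H :* g) * U)%g | g : gT].

Section Reduction.
Variables (R : comNzRingType) (I J : idealr R).

Definition reduction (sIJ : {subset I <= J}) (x : {ideal_quot I}) : {ideal_quot J} :=
  \pi_{ideal_quot J} (repr x).

Variable sIJ : {subset I <= J}.
Local Notation red := (reduction sIJ).

Lemma reduction_pi (x : R) : red (\pi_{ideal_quot I} x) = \pi_{ideal_quot J} x.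
Proof.
apply/eqP; rewrite /reduction -Quotient.idealrBE; apply: sIJ.
by rewrite Quotient.idealrBE reprK.
Qed.

Lemma reduction_is_zmod_morphism : zmod_morphism red.
Proof.
elim/quotW=> x; elim/quotW=> y.
by rewrite -raddfB !reduction_pi raddfB.
Qed.

Lemma reduction_is_monoid_morphism : monoid_morphism red.
Proof.
split=> [|]; first by rewrite -[1](rmorph1 \pi) reduction_pi rmorph1.
by elim/quotW=> x; elim/quotW=> y; rewrite -rmorphM !reduction_pi rmorphM.
Qed.

HB.instance Definition _ := GRing.isZmodMorphism.Build _ _ red
  reduction_is_zmod_morphism.
HB.instance Definition _ := GRing.isMonoidMorphism.Build _ _ red
  reduction_is_monoid_morphism.

End Reduction.

Section Level.
Variables (K : fieldExtType rat) (p : nz_prime_idealr 'O_K).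

(* Exponents are shifted by one: the parameters k and j stand for the moduli
   p^(k.+1) and p^(j.+1), since p^0 is not a proper ideal. *)
Definition rho (k j : nat) (le_jk : (j <= k)%N) :
    SL2 {ideal_quot (ideal_exp p k.+1)} -> SL2 {ideal_quot (ideal_exp p j.+1)} :=
  SL2_map (reduction (@ideal_exp_sub _ p j.+1 k.+1 le_jk)).

(* Exact level e = k.+1. *)
Definition exact_level (k : nat) :
    {group SL2 {ideal_quot (ideal_exp p k.+1)}} -> Prop :=
  match k with
  | 0 => fun H => H <> [set: _] :> {set _}
  | k'.+1 => fun H =>
      (H : {set _}) <> rho (leqnSn k') @^-1: (rho (leqnSn k') @: H)
  end.

End Level.

(* Main.v *)
Require Import Defs.
From HB Require Import structures.
From mathcomp Require Import all_boot all_order all_fingroup all_algebra all_field.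
From mathcomp Require Import generic_quotient ring_quotient boolp reals exp.
From mathcomp Require Import cyclic ring lra zify.

Set Implicit Arguments.
Unset Strict Implicit.
Unset Printing Implicit Defensive.

Import Order.TTheory GRing.Theory Num.Theory.
Local Open Scope ring_scope.
Local Open Scope quotient_scope.

(** Write e for the level, q for the order of O/p, A for O/p^e and G for
    SL_2(A).  Counting double cosets through the stabilisers of the U-action on
    H\G shows that the ratio to be bounded is the mean, over g in G, of the
    density in A of
      X_g = { x | g (1 x; 0 1) g^-1 lies in H }
    ([sum_card_conj_cap]).  Let T be about e/2 and let pi generate the maximal
    ideal of A; call g good when X_g contains the ideal pi^T A.

    If g is bad, then X_g has density at most q^(-(T+1)/n)
    ([card_cap_unipotent_le]).  For let m be the index of X_g in A; then X_g
    contains m A.  An integer m outside p^(T+1) has pi^T A in m A, so m must lie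
    in p^(T+1); hence q^(T+1) <= |O/mO| <= m^n because O has rank at most n
    over Z ([card_residue_exp_le], [card_incongruent_le]).  This is where the
    degree n enters.

    Good g are rare ([card_contains_unip_le]).  The subgroup of H given by a good
    g is attached to the line spanned by the first column (a, c) of g: it consists
    of the matrices 1 + x N with x in pi^T A and N = (-ac a^2; -c^2 ac).  Suppose
    that three good lines are pairwise distinct modulo pi^(s+1).  The Vandermonde
    determinant of the three vectors (a^2, ac, c^2) is the product of the pairwise
    determinants of the lines, so it divides pi^(3s), and the three matrices N span
    a module containing pi^(3s) sl_2(A).  Since pi^(2T) = 0, the elements
    1 + pi^T Y multiply by adding the Y, so H contains every matrix congruent to 1
    modulo pi^(T+3s) ([mem_three_conjugates]).  When T + 3s <= e - 1 this includes
    the kernel of reduction to level e - 1, contrary to exactness of the level.  So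
    the good g lie in at most two cosets of Gamma_0(pi^(s+1)), a subgroup of index
    at least q^(s+1).

    Altogether the ratio is at most q^(-(T+1)/n) + 2 q^(-(s+1)), and both T and s
    grow linearly with e.

    The structure of O/p^e that this uses (its ideals are the powers of one
    element, and its order is at least q^e) rests on the fact that p is
    principal locally at p ([local_uniformizer]). *)

(** * The rank of the ring of integers *)

(** At most [m ^ \dim K] elements of O can be pairwise incongruent modulo [m],
    even though no finite basis of O over Z is at hand.  The Smith normal form of
    the coordinate matrix of the given elements provides a unimodular change of
    generators after which all but the first [\dim K] generators vanish; the
    residues modulo [m] of the remaining coefficients determine each element
    modulo [m O]. *)
Lemma card_incongruent_le (K : fieldExtType rat) (m : nat) (T : finType)
    (x : T -> 'O_K) :
  (0 < m)%N -> (forall s t z, x s - x t = z *+ m -> s = t) ->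
  (#|T| <= m ^ \dim {:K})%N.
Proof.
case: m => // m _ x_inj; set d := \dim {:K}; set N := #|T|.
pose X := \matrix_(i < N, j < d) coord (vbasis {:K}) j (val (x (enum_val i))).
have [D nzD [Z DZ]] : exists2 D : int, D != 0 &
    exists Z : 'M[int]_(N, d), D%:~R *: X = map_mx intr Z.
  exists (\prod_(u : 'I_N * 'I_d) denq (X u.1 u.2)).
    by rewrite prodf_seq_neq0; apply/allP=> u _; rewrite denq_neq0.
  suff /fin_all_exists[Z DZ] (u : 'I_N * 'I_d) : exists z : int,
      (\prod_(v : 'I_N * 'I_d) denq (X v.1 v.2))%:~R * X u.1 u.2 = z%:~R.
    by exists (\matrix_(i, j) Z (i, j)); apply/matrixP=> i j;
      rewrite [LHS]mxE [RHS]mxE [in RHS]mxE (DZ (i, j)).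
  rewrite (bigD1 u) //=; set r := \prod_(_ | _) _; exists (r * numq (X u.1 u.2)).
  by rewrite !intrM numqE; ring.
have [L uL [Q _ [s _ defZ]]] := int_Smith_normal_form Z.
pose c (v : 'rV[int]_N) : 'O_K := \sum_k x (enum_val k) *~ v 0 k.
have cB u v : c (u - v) = c u - c v.
  by rewrite /c -sumrB; apply: eq_bigr => k _; rewrite !mxE mulrzBr.
have cZ a u : c (a *: u) = c u *~ a.
  by rewrite /c mulrz_suml; apply: eq_bigr => k _; rewrite mxE mulrC mulrzA.
have c_delta i : c (delta_mx 0 i) = x (enum_val i).
  rewrite /c (bigD1 i) //= big1 ?addr0; first by rewrite mxE !eqxx.
  by move=> k /negPf ne_ki; rewrite mxE ne_ki andbF.
have c0 v : v *m Z = 0 -> c v = 0.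
  move=> vZ0; apply/eqP; rewrite -int_val_eq0; apply/eqP.
  rewrite [LHS](coord_vbasis (memvf _)) big1 // => l _.
  suff -> : coord (vbasis {:K}) l (val (c v)) = 0 by rewrite scale0r.
  have nzDr : D%:~R != 0 :> rat by rewrite intr_eq0.
  apply: (mulfI nzDr); rewrite mulr0 raddf_sum linear_sum mulr_sumr.
  transitivity (((v *m Z) 0 l)%:~R : rat); last by rewrite vZ0 mxE.
  rewrite mxE rmorph_sum; apply: eq_bigr => k _.
  move/matrixP/(_ k l): DZ; rewrite !mxE rmorphM /= => <-.
  have -> : int_val (x (enum_val k) *~ v 0 k) = (v 0 k)%:~R *: int_val (x (enum_val k)).
    by rewrite scaler_int; apply: (raddfMz val).
  by rewrite linearZ mulrCA.
pose Lt t (j : nat) : int := if insub j is Some i then L (enum_rank t) i else 0.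
pose g t : {ffun 'I_d -> 'I_m.+1} := [ffun j : 'I_d => inord `|(Lt t j %% m.+1)%Z|].
suff /leq_card: injective g by rewrite card_ffun !card_ord.
move=> t t' eq_g.
(* [u *m invmx L] is the difference of the unit vectors of [t] and [t'].  The first
   [d] entries of [u] are [m.+1] times those of [w]; the other entries meet zero
   rows of the Smith form. *)
have [u def_u]: {u | u = row (enum_rank t) L - row (enum_rank t') L} by eexists.
pose w : 'rV[int]_N := \row_j (if (j < d)%N then (u ord0 j %/ m.+1)%Z else 0).
apply: (x_inj _ _ (c (w *m invmx L))).
have ->: x t - x t' = c (u *m invmx L).
  by rewrite def_u mulmxBl -!row_mul mulmxV // !row1 cB !c_delta !enum_rankK //.
apply/eqP; rewrite -subr_eq0 -[_ *+ _]/(_ *~ Posz m.+1) -cZ -cB scalemxAl -mulmxBl; apply/eqP/c0.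
rewrite defZ -!mulmxA mulKmx // mulmxA [X in X *m Q](_ : _ = 0) ?mul0mx //.
apply/rowP=> l; rewrite mxE [RHS]mxE big1 // => j _; rewrite [X in _ * X]mxE.
have [eq_jl | _] := eqVneq (j : nat) l; last by rewrite mulr0n mulr0.
have lt_jd: (j < d)%N by rewrite eq_jl.
rewrite mulr1n [X in X * _](_ : _ = 0) ?mul0r // !mxE lt_jd.
suff: (m.+1 %| u ord0 j)%Z by move/divzK; rewrite mulrC => ->; rewrite subrr.
have /ffunP/(_ (Ordinal lt_jd)) := eq_g; rewrite !ffunE.
have lt_mod (a : int) : (`|(a %% m.+1)%Z| < m.+1)%N.
  by rewrite -ltz_nat gez0_abs ?modz_ge0 ?ltz_pmod.
move/(congr1 (@nat_of_ord _)); rewrite !inordK ?lt_mod // => /(congr1 Posz).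
by rewrite !gez0_abs ?modz_ge0 // /Lt /= valK => /eqP; rewrite eqz_mod_dvd def_u !mxE.
Qed.

(** * Local structure at a nonzero prime ideal *)

Lemma collision (T : finType) (f : nat -> T) :
  exists i j, (i < j)%N /\ f i = f j.
Proof.
pose g (i : 'I_#|T|.+1) := f i.
have /injectiveP/injectivePn[i [j ne_ij eq_g]]: ~ injective g.
  by move/leq_card; rewrite card_ord ltnn.
case: (ltngtP i j) => [lt_ij | lt_ji | /val_inj/eqP]; last by rewrite (negPf ne_ij).
  by exists i, j.
by exists j, i.
Qed.

(** The prime [p] is associated to the finite ring O/I.  The elements of [p] modulo
    [I] are killed one at a time, keeping the invariant that the annihilator of [b]
    in O/I lies in [p]: since O/I is finite, some power [y ^+ i] with [y]
    in [p] makes the annihilator of [y ^+ i * b] leave [p], and the last power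
    before that happens, multiplied by a witness outside [p], keeps the invariant
    and is killed by [y]. *)
Lemma prime_annihilator (K : fieldExtType rat) (p : nz_prime_idealr 'O_K)
    (I : nz_idealr 'O_K) :
    {subset I <= p} ->
  exists2 b, b \notin I & forall y, y \in p -> y * b \in I.
Proof.
move=> pI.
suff [b pb allb]: exists2 b, forall z, z * b \in I -> z \in p &
    forall t : {ideal_quot I}, repr t \in p -> repr t * b \in I.
  exists b => [|y py].
    by apply/negP=> Ib; have := pb 1; rewrite mul1r idealr1 => /(_ Ib).
  have Iy: y - repr (\pi_{ideal_quot I} y) \in I by rewrite Quotient.idealrBE reprK.
  rewrite -[y](subrK (repr (\pi_{ideal_quot I} y))) mulrDl rpredD //.
    by rewrite mulrC idealMr.
  by apply: allb; rewrite -[X in X \in p](subKr y) rpredB // pI.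
suff [b pb allb]: exists2 b, forall z, z * b \in I -> z \in p &
    forall t : {ideal_quot I}, t \in enum {: {ideal_quot I}} -> repr t \in p -> repr t * b \in I.
  by exists b => // t; apply: allb; rewrite mem_enum.
elim: (enum _) => [|t s [b pb allb]].
  by exists 1 => // z; rewrite mulr1; apply: pI.
have [pt | p't] := boolP (repr t \in p); last first.
  by exists b => // t'; rewrite inE => /predU1P[-> | /allb//]; rewrite (negPf p't).
set y := repr t in pt *.
have ex_i: exists i, `[< exists2 z, z \notin p & z * (y ^+ i * b) \in I >].
  have [i [j [lt_ij eq_f]]] := collision (fun i => \pi_{ideal_quot I} (y ^+ i * b)).
  (* [1 - y ^+ (j - i)] kills [y ^+ i * b] and is congruent to 1 modulo [p]. *)
  exists i; apply/asboolP; exists (1 - y ^+ (j - i)).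
    apply/negP=> p1; suff: 1 \in p by rewrite idealr1.
    rewrite -[1](subrK (y ^+ (j - i))) rpredD //.
    by rewrite -(prednK (n := j - i)) ?subn_gt0 // exprSr idealMr.
  rewrite mulrBl mul1r mulrA -exprD subnK ?(ltnW lt_ij) //.
  by rewrite Quotient.idealrBE; apply/eqP.
case: (ex_minnP ex_i) => -[|i] /asboolP[z p'z Iz] min_i.
  by rewrite expr0 mul1r in Iz; rewrite (pb _ Iz) in p'z.
exists (z * (y ^+ i * b)) => [x | t'].
  rewrite mulrA => Ix; apply: contraT => p'x.
  have /min_i: `[< exists2 z, z \notin p & z * (y ^+ i * b) \in I >].
    by apply/asboolP; exists (x * z) => //; rewrite prime_idealrM negb_or p'x.
  by rewrite ltnn.
rewrite inE => /predU1P[-> _ | /allb{}allb /allb].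
  by rewrite mulrCA [y * _]mulrA -exprS.
by rewrite !mulrA [_ * z]mulrC -!mulrA [_ * (y ^+ i * b)]mulrCA => Ib; rewrite 2?idealMr.
Qed.

(** [x] is invertible in the finite domain O/p; if [y] and [z] invert it modulo
    [p ^ m] and [p], the product [(1 - x * y) * (1 - x * z)] exhibits an inverse
    modulo [p ^ m.+1]. *)
Lemma unit_mod_ideal_exp (K : fieldExtType rat) (p : nz_prime_idealr 'O_K) x m :
  x \notin p -> exists y, 1 - x * y \in ideal_exp p m.
Proof.
move=> p'x; elim: m => [|m [y py]]; first by exists 0.
have [z pz]: exists z, 1 - x * z \in p.
  have inj_x: injective (fun z : {ideal_quot p} => \pi_{ideal_quot p} x * z).
    move=> z1 z2 /eqP; rewrite -subr_eq0 -mulrBr => /eqP/Quotient.rquot_IdomainAxiom.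
    rewrite subr_eq0 => /orP[] /eqP // x0; case/negP: p'x.
    by rewrite -[x]subr0 Quotient.idealrBE -[X in X == _]/(\pi_{ideal_quot p} x) x0 rmorph0.
  have [z] := codomP (injF_onto inj_x 1); rewrite -[z]reprK -rmorphM -[1](rmorph1 \pi_{ideal_quot p}).
  by move=> /eqP; rewrite -Quotient.idealrBE => pz; exists (repr z).
exists (y + z - x * (y * z)).
have ->: 1 - x * (y + z - x * (y * z)) = (1 - x * z) * (1 - x * y) by ring.
apply/asboolP; exists 1, (fun=> 1 - x * z), (fun=> 1 - x * y).
by split=> //; rewrite big_ord1.
Qed.

Lemma int_mulfI (K : fieldExtType rat) (x y z : 'O_K) :
  x != 0 -> x * y = x * z -> y = z.
Proof.
move=> nzx /eqP; rewrite -subr_eq0 -mulrBr int_mul_eq0 (negPf nzx) subr_eq0.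
by move/eqP.
Qed.

Lemma principal_nz_ideal (K : fieldExtType rat) (p : nz_prime_idealr 'O_K) x :
    x \in p -> x != 0 ->
  exists I : nz_idealr 'O_K, forall y, y \in I <-> exists z, y = x * z.
Proof.
move=> px nzx; pose xO : {pred 'O_K} := fun y => `[< exists z, y = x * z >].
have xO_closed: idealr_closed xO.
  split; first by apply/asboolP; exists 0; rewrite mulr0.
    apply/negP=> /asboolP[z def1]; have := idealr1 p.
    by rewrite def1 mulrC idealMr.
  move=> a _ _ /asboolP[y ->] /asboolP[z ->]; apply/asboolP.
  by exists (a * y + z); rewrite mulrDr mulrCA.
have xO_nz: exists2 y, y \in xO & y != 0.
  by exists x => //; apply/asboolP; exists 1; rewrite mulr1.
pose I : nz_idealr 'O_K :=
  HB.pack xO (isIdealr.Build _ xO xO_closed) (isNonzeroIdeal.Build _ xO xO_nz).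
by exists I => y; split=> [/asboolP | ?] //; apply/asboolP.
Qed.

(** The fraction [b / a] multiplies [p] into itself, and O is integrally closed.
    With [x] nonzero in [p], all the multiples of [x] by powers of [b / a] lie in O,
    and two of them agree modulo [x O]; dividing by [x] gives
    [(b / a) ^ j - (b / a) ^ i] in O, a monic equation over O.  This replaces the
    usual appeal to finite generation of [p]. *)
Lemma stabilizer_integral (K : fieldExtType rat) (p : nz_prime_idealr 'O_K)
    (a b : 'O_K) :
    a != 0 -> (forall y, y \in p -> exists2 z, z \in p & y * b = a * z) ->
  exists c, b = a * c.
Proof.
move=> nza stab; have [x px nzx] := nonzero_ideal_subproof (s := p).
have [I defI] := principal_nz_ideal px nzx.
have /choice[f f_p]: forall i, exists y, y \in p /\ b ^+ i * x = a ^+ i * y.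
  elim=> [|i [y [py IH]]]; first by exists x; rewrite !expr0.
  have [z pz def_z] := stab y py; exists z; split=> //.
  by rewrite !exprSr mulrAC IH -[LHS]mulrA def_z mulrA.
have [i [j [lt_ij eq_g]]] := collision (fun i => \pi_{ideal_quot I} (f i)).
have /defI[z def_z]: f i - f j \in I by rewrite Quotient.idealrBE; apply/eqP.
have nzaK: val a != 0 by rewrite int_val_eq0.
have nzxK: val x != 0 by rewrite int_val_eq0.
pose c : K := val b / val a; have ac: val a * c = val b by rewrite mulrC divfK.
have fE k : val (f k) = c ^+ k * val x.
  have [_ /(congr1 val)] := f_p k; rewrite !rmorphM !rmorphXn /= => def_f.
  by apply: (mulfI (expf_neq0 k nzaK)); rewrite -def_f mulrA -exprMn ac.
have c_int: c \in algebraic_integers K.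
  apply/algebraic_integersP.
  pose q : {poly K} := 'X^j - ('X^i - (val z)%:P).
  apply: (@integral_root_monic _ _ _ _ q).
  - rewrite monicE lead_coefDl ?lead_coefXn // size_polyXn size_polyN.
    rewrite (leq_ltn_trans (size_polyD _ _)) // size_polyXn size_polyN.
    by rewrite gtn_max !ltnS lt_ij (leq_trans (size_polyC_leq1 _)) ?(leq_ltn_trans _ lt_ij).
  - rewrite /root !hornerE subr_eq0; apply/eqP.
    apply: (mulIf nzxK); rewrite mulrBl -!fE [_ * val x]mulrC -rmorphM -def_z.
    by rewrite rmorphB /= subKr.
  apply/integral_poly=> k; rewrite !coefB coefC !coefXn.
  apply: integral_sub; first exact: integral_nat.
  apply: integral_sub; first exact: integral_nat.
  case: ifP => _; last exact: integral0.
  exact/algebraic_integersP/valP.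
exists (RingOfIntegers c_int); apply: val_inj.
by rewrite rmorphM /= ac.
Qed.

(** In the localisation of O at [p], the maximal ideal is generated by [w]; the
    denominator [u], which serves all of [p], keeps the statement inside O. *)
Definition uniformizing (K : fieldExtType rat) (p : nz_prime_idealr 'O_K) w u :=
  [/\ w \in p, w != 0, u \notin p & forall y, y \in p -> exists z, u * y = w * z].

(** The product of [p] with its inverse fractional ideal is not [p].  With [x] in
    [p] and [b] annihilating [p] in O/xO, the fraction [b / x] maps [p] into O but
    is not integral, so it cannot map [p] into itself: some [w] in [p] goes to an
    element [u] outside [p], and then [u * y = w * (b / x * y)] for all [y] in
    [p]. *)
Lemma local_uniformizer (K : fieldExtType rat) (p : nz_prime_idealr 'O_K) :
  exists w u, uniformizing p w u.
Proof.
have [x px nzx] := nonzero_ideal_subproof (s := p).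
have [I defI] := principal_nz_ideal px nzx.
have [|b I'b bp] := @prime_annihilator K p I.
  by move=> _ /defI[z ->]; rewrite mulrC idealMr.
suff: exists w u, [/\ w \in p, u \notin p & w * b = x * u].
  case=> w [u [pw p'u def_u]].
  have wp y : y \in p -> exists z, u * y = w * z.
    move=> /bp/defI[z def_z]; exists z; apply: (int_mulfI nzx).
    by rewrite mulrA -def_u -mulrA [b * y]mulrC def_z mulrCA.
  exists w, u; split=> //.
  have [z] := wp x px; apply: contraPneq => ->; rewrite mul0r => /eqP.
  rewrite int_mul_eq0 (negPf nzx) orbF => /eqP u0.
  by rewrite u0 rpred0 in p'u.
apply: contrapT => no_w; case/negP: I'b; apply/defI.
apply: (stabilizer_integral (p := p) nzx) => y py.
have /defI[z def_z] := bp y py; exists z => //.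
by apply: contrapT => /negP p'z; case: no_w; exists y, z.
Qed.

Section Uniformizer.
Variables (K : fieldExtType rat) (p : nz_prime_idealr 'O_K) (w u : 'O_K).
Hypothesis wu : uniformizing p w u.

Lemma mem_prime_ideal_expX x m : (x ^+ m \in p) -> x \in p.
Proof.
elim: m => [|m IHm]; first by rewrite expr0 idealr1.
by rewrite exprS prime_idealrM => /orP[].
Qed.

(** The powers of [p] are the valuation ideals: up to the unit [u] of the
    localisation, [x] lies in [p ^ j] when [w ^+ j] divides it.  Everything else
    about powers of [p] is read off from this. *)
Lemma mem_ideal_expP j x :
  x \in ideal_exp p j <-> exists z, u ^+ j * x = w ^+ j * z.
Proof.
have [pw _ p'u up] := wu; split.
  elim: j x => [|j IHj] x; first by exists x; rewrite !expr0.
  case/asboolP=> m [a [b [pa pb ->]]].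
  have /choice[f f_p] i : exists z, u ^+ j.+1 * (a i * b i) = w ^+ j.+1 * z.
    have [[y ay] [z bz]] := (up _ (pa i), IHj _ (pb i)).
    by exists (y * z); rewrite !exprS mulrACA ay bz mulrACA.
  exists (\sum_i f i); rewrite !mulr_sumr; exact: eq_bigr.
case=> z def_z; have [pj0 pjD] := ideal_exp_closed p j.
have pw_j : w ^+ j \in ideal_exp p j.
  elim: (j) => [|i IHi]; first by rewrite expr0.
  apply/asboolP; exists 1, (fun=> w), (fun=> w ^+ i).
  by split=> //; rewrite big_ord1 exprS.
have /(unit_mod_ideal_exp j)[v pv] : u ^+ j \notin p.
  by apply: contraNN p'u; apply: mem_prime_ideal_expX.
have ->: x = x * (1 - u ^+ j * v) + (v * z * w ^+ j + 0).
  by rewrite addr0 -[v * z * _]mulrA [z * _]mulrC -def_z; ring.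
by rewrite !pjD.
Qed.

Lemma mem_ideal_expS_mulw j x : w * x \in ideal_exp p j.+1 -> x \in ideal_exp p j.
Proof.
have [_ nzw p'u _] := wu.
case/mem_ideal_expP=> z; rewrite [w ^+ _]exprS mulrCA -mulrA.
move/(int_mulfI nzw) => def_z.
have /(unit_mod_ideal_exp j)[v pv] := p'u.
have [pj0 pjD] := ideal_exp_closed p j.
have: u * x \in ideal_exp p j by apply/mem_ideal_expP; exists z; rewrite mulrA -exprSr.
move=> pux; have ->: x = x * (1 - u * v) + (v * (u * x) + 0) by ring.
by rewrite !pjD.
Qed.

Lemma mem_ideal_exp_multiple j m x : x \in ideal_exp p j ->
  exists y, x - y * w ^+ j \in ideal_exp p m.
Proof.
have [_ _ p'u _] := wu => /mem_ideal_expP[z def_z].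
have /(unit_mod_ideal_exp m)[v pv] : u ^+ j \notin p.
  by apply: contraNN p'u; apply: mem_prime_ideal_expX.
exists (v * z); have [pm0 pmD] := ideal_exp_closed p m.
have ->: x - v * z * w ^+ j = x * (1 - u ^+ j * v) + 0.
  by rewrite addr0 -[v * z * _]mulrA [z * _]mulrC -def_z; ring.
exact: pmD.
Qed.

Lemma notin_ideal_exp_divides j m x : x \notin ideal_exp p j.+1 ->
  exists y, w ^+ j - y * x \in ideal_exp p m.
Proof.
have [_ _ p'u up] := wu; have [pm0 pmD] := ideal_exp_closed p m.
elim: j => [|j IHj] p'x.
  have: x \notin p by rewrite ideal_exp1E in p'x.
  by case/(unit_mod_ideal_exp m)=> y py; exists y; rewrite expr0 mulrC.
have [/mem_ideal_expP[z def_z]|/IHj[y py]] := boolP (x \in ideal_exp p j.+1); last first.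
  exists (w * y); rewrite exprS -mulrA -mulrBr -[X in X \in _]addr0; exact: pmD.
have p'z: z \notin p.
  apply: contraNN p'x => /up[t def_t]; apply/mem_ideal_expP; exists t.
  by rewrite exprS -mulrA def_z mulrCA def_t mulrA -exprSr.
have [v pv] := unit_mod_ideal_exp m p'z.
exists (v * u ^+ j.+1); rewrite -mulrA def_z.
rewrite (_ : _ - _ = w ^+ j.+1 * (1 - z * v) + 0); first exact: pmD.
by rewrite addr0; ring.
Qed.

(** The expansion in base [w] with digits in a set of representatives of O/p; the
    head of the sequence is the lowest digit. *)
Fixpoint digit_expansion (s : seq {ideal_quot p}) : 'O_K :=
  if s is d :: s' then repr d + w * digit_expansion s' else 0.

(** This bounds the order of O/p^r from below by the r-th power of that of O/p. *)
Lemma digit_expansion_inj s t : size s = size t ->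
  digit_expansion s - digit_expansion t \in ideal_exp p (size s) -> s = t.
Proof.
have [pw _ _ _] := wu.
elim: s t => [|d s IHs] [|d' t] //= [eq_sz] p_st.
have eq_d: d = d'.
  move/(ideal_exp_sub (ltn0Sn _)): (p_st); rewrite ideal_exp1E.
  rewrite (_ : _ - _ = repr d - repr d' + (digit_expansion s - digit_expansion t) * w).
    rewrite rpredDr ?idealMr // Quotient.idealrBE.
    by rewrite !reprK => /eqP.
  by ring.
move: p_st; rewrite {}eq_d opprD addrACA subrr add0r -mulrBr.
by move/mem_ideal_expS_mulw/IHs->.
Qed.

End Uniformizer.

(** * Unipotent elements of SL2 and their conjugates *)

Section SL2Entries.
Variable A : finComNzRingType.
Implicit Types g h : SL2 A.

Lemma ord2_lift01 : lift 0 0 = 1 :> 'I_2. Proof. exact: val_inj. Qed.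
Lemma ord2_lift10 : lift 1 0 = 0 :> 'I_2. Proof. exact: val_inj. Qed.

Lemma SL2_eqP g h :
  g 0 0 = h 0 0 -> g 0 1 = h 0 1 -> g 1 0 = h 1 0 -> g 1 1 = h 1 1 -> g = h.
Proof.
move=> e00 e01 e10 e11; apply: val_inj; apply/matrixP=> i j.
have ord2 (l : 'I_2) : l = 0 \/ l = 1.
  by case: l => [[|[|]]] // ?; [left | right]; apply: val_inj.
by case: (ord2 i) => ->; case: (ord2 j) => ->.
Qed.

Lemma SL2_mulE g h i j : (g * h)%g i j = g i 0 * h 0 j + g i 1 * h 1 j.
Proof. by rewrite [LHS]mxE big_ord_recl big_ord1 ord2_lift01. Qed.

Lemma SL2_detE g : g 0 0 * g 1 1 - g 0 1 * g 1 0 = 1.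
Proof.
rewrite -[RHS](eqP (SL2_valP g)) (expand_det_row _ 0) big_ord_recl big_ord1.
rewrite /cofactor !det_mx11 !mxE !ord2_lift01 ord2_lift10 /=.
by rewrite expr0 expr1 mul1r mulN1r mulrN.
Qed.

Lemma SL2_oneE i j : (1%g : SL2 A) i j = (i == j)%:R.
Proof. by rewrite [LHS]mxE. Qed.

Lemma SL2_invE g :
  [/\ g^-1%g 0 0 = g 1 1, g^-1%g 0 1 = - g 0 1,
      g^-1%g 1 0 = - g 1 0 & g^-1%g 1 1 = g 0 0].
Proof.
by split; rewrite [LHS]mxE /cofactor det_mx11 !mxE ?(ord2_lift10, ord2_lift01) /=
  ?expr0 ?expr1 ?sqrrN ?expr1n ?mulN1r ?mul1r.
Qed.

Lemma unipE (x : A) :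
  [/\ unip x 0 0 = 1, unip x 0 1 = x, unip x 1 0 = 0 & unip x 1 1 = 1].
Proof.
have l0 : lshift 1 (ord0 : 'I_1) = 0 :> 'I_2 by apply: val_inj.
have r1 : rshift 1 (ord0 : 'I_1) = 1 :> 'I_2 by apply: val_inj.
have := block_mxEul (1%:M : 'M[A]_1) x%:M 0 1%:M 0 0.
have := block_mxEur (1%:M : 'M[A]_1) x%:M 0 1%:M 0 0.
have := block_mxEdl (1%:M : 'M[A]_1) x%:M 0 1%:M 0 0.
have := block_mxEdr (1%:M : 'M[A]_1) x%:M 0 1%:M 0 0.
by rewrite l0 r1 !mxE.
Qed.
End SL2Entries.

Section ThreeConjugates.
Variables (A : finComNzRingType) (H : {group SL2 A}).
Implicit Types (a x : A) (g h : SL2 A).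

Definition multiples a : {set A} := [set a * x | x : A].

Lemma multiplesP a x : reflect (exists y, x = a * y) (x \in multiples a).
Proof. by apply: (iffP imsetP) => -[y]; [move=> _ ->|move=> ->]; exists y. Qed.

Lemma conj_unipE g x (u := (unip x ^ g^-1)%g) :
  [/\ u 0 0 = 1 - x * (g 0 0 * g 1 0), u 0 1 = x * g 0 0 ^+ 2,
      u 1 0 = - (x * g 1 0 ^+ 2) & u 1 1 = 1 + x * (g 0 0 * g 1 0)].
Proof.
have [i00 i01 i10 i11] := SL2_invE g; have [u00 u01 u10 u11] := unipE x.
have def1 := SL2_detE g.
rewrite {}/u /conjg invgK; split; rewrite !SL2_mulE ?i00 ?i01 ?i10 ?i11 u00 u01 u10 u11.
- by rewrite -[in RHS]def1; ring.
- by ring.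
- by ring.
- by rewrite -[in RHS]def1; ring.
Qed.

Definition contains_unip a g := [forall y, unip (a * y) \in (H :^ g)%g].

Lemma contains_unip_conj a g y : contains_unip a g -> (unip (a * y)%R ^ g^-1)%g \in H.
Proof. by move=> /forallP/(_ y); rewrite mem_conjg. Qed.

(** By [conj_unipE], the conjugate by [g] of the unipotent matrix of [P * x] is
    [1 + P x N], where [N] has entries [-ac], [a^2], [-c^2], [ac] for [(a, c)] the
    first column of [g]; as [P * P = 0], such matrices multiply by adding the
    [x N].  So [h] is to be reached by a combination of three matrices [N], that
    is, of three vectors [(a^2, ac, c^2)], whose determinant is the product of the
    three [d g g']. *)
Lemma mem_three_conjugates P c g1 g2 g3 h (d := fun g g' => g 0 0 * g' 1 0 - g' 0 0 * g 1 0) :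
    P * P = 0 -> contains_unip P g1 -> contains_unip P g2 -> contains_unip P g3 ->
    c \in multiples (d g1 g2 * d g1 g3 * d g2 g3) ->
    h 0 0 - 1 \in multiples (P * c) -> h 0 1 \in multiples (P * c) ->
    h 1 0 \in multiples (P * c) -> h 1 1 - 1 \in multiples (P * c) ->
  h \in H.
Proof.
move=> P2 H1 H2 H3 /multiplesP[t def_c] /multiplesP[w1 h00] /multiplesP[w0 h01].
move=> /multiplesP[w2 h10] /multiplesP[w1' h11].
have {}h00: h 0 0 = 1 + P * c * w1 by rewrite -h00; ring.
have {}h11: h 1 1 = 1 + P * c * w1' by rewrite -h11; ring.
have def_w1': P * c * w1' = - (P * c * w1).
  have ->: P * c * w1' = (1 + P * c * w1) * (1 + P * c * w1') - P * c * w0 * (P * c * w2)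
     - 1 - P * c * w1 + P * P * (c * w0 * c * w2 - c * w1 * (c * w1')) by ring.
  by rewrite -h00 -h11 -h01 -h10 SL2_detE P2; ring.
rewrite {}def_w1' in h11.
(* Lagrange interpolation: [q g g'] is the linear form that vanishes on the vectors
   [(a^2, ac, c^2)] of [g] and [g'], evaluated at [(w0, - w1, - w2)]. *)
pose q (g g' : SL2 A) := g 1 0 * g' 1 0 * w0 + (g' 0 0 * g 1 0 + g 0 0 * g' 1 0) * w1
    - g 0 0 * g' 0 0 * w2.
pose x1 := t * d g2 g3 * q g2 g3.
pose x2 := - (t * d g1 g3 * q g1 g3).
pose x3 := t * d g1 g2 * q g1 g2.
suff ->: h = (unip (P * x1)%R ^ g1^-1 * unip (P * x2)%R ^ g2^-1 * unip (P * x3)%R ^ g3^-1)%g.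
  by apply: groupM; first apply: groupM; apply: contains_unip_conj.
have s0 : c * w0 = x1 * g1 0 0 ^+ 2 + x2 * g2 0 0 ^+ 2 + x3 * g3 0 0 ^+ 2.
  by rewrite def_c /x1 /x2 /x3 /q /d; ring.
have s1 : c * w1 = - (x1 * (g1 0 0 * g1 1 0) + x2 * (g2 0 0 * g2 1 0) + x3 * (g3 0 0 * g3 1 0)).
  by rewrite def_c /x1 /x2 /x3 /q /d; ring.
have s2 : c * w2 = - (x1 * g1 1 0 ^+ 2 + x2 * g2 1 0 ^+ 2 + x3 * g3 1 0 ^+ 2).
  by rewrite def_c /x1 /x2 /x3 /q /d; ring.
have := conj_unipE g1 (P * x1).
have := conj_unipE g2 (P * x2).
have := conj_unipE g3 (P * x3).
move: (unip (P * x1)%R ^ g1^-1)%g (unip (P * x2)%R ^ g2^-1)%g (unip (P * x3)%R ^ g3^-1)%g.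
move: (x1) (x2) (x3) s0 s1 s2 => {x1 x2 x3} x1 x2 x3 s0 s1 s2 u v w.
move=> [w00 w01 w10 w11] [v00 v01 v10 v11] [u00 u01 u10 u11].
apply: (@SL2_eqP A); rewrite !SL2_mulE !(u00, u01, u10, u11, v00, v01, v10, v11, w00, w01, w10, w11).
- by rewrite h00 -mulrA s1; ring: P2.
- by rewrite h01 -mulrA s0; ring: P2.
- by rewrite h10 -mulrA s2; ring: P2.
- by rewrite h11 -mulrA s1; ring: P2.
Qed.

End ThreeConjugates.

(** * Counting double cosets *)

(** The double coset [H g U] has [#|H| * #|U| / #|U :&: H :^ g|] elements, so each
    double coset contributes [#|H| * #|U|] to the sum. *)
Lemma sum_card_conj_cap (gT : finGroupType) (H U : {group gT}) :
  (\sum_(g : gT) #|U :&: (H :^ g)%g| = #|double_cosets H U| * (#|H| * #|U|))%N.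
Proof.
pose D g := ((H :* g) * U)%g.
have D_id g : g \in D g by rewrite -[X in X \in _]mulg1 mem_mulg ?rcoset_refl.
have D_eq g g' : g' \in D g -> D g' = D g.
  case/mulsgP=> _ u /rcosetP[h Hh ->] Uu ->.
  by rewrite /D !rcosetM (rcoset_id Hh) -mulgA (lcoset_id Uu).
have cardD g : (#|U :&: (H :^ g)%g| * #|D g| = #|H| * #|U|)%N.
  have ->: #|D g| = #|((H :^ g) * U)%g|.
    by rewrite conjsgE -mulgA card_lcoset.
  by rewrite setIC mulnC -mul_cardG cardJg.
rewrite (partition_big_imset D) /= -[imset _ _]/(double_cosets H U).
rewrite -sum_nat_const; apply: eq_bigr => _ /imsetP[g _ ->].
rewrite -(cardD g) mulnC -sum_nat_const.
apply: eq_big => [g' | g' /eqP eqD].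
  by apply/eqP/idP => [eqD | /D_eq//]; have := D_id g'; rewrite (eqD : D g' = D g).
apply/eqP; rewrite -(eqn_pmul2r (m := #|D g|)); last by apply/card_gt0P; exists g.
by rewrite cardD -(cardD g') (eqD : D g' = D g).
Qed.

Lemma card_double_cosets_le (gT : finGroupType) (H U : {group gT}) :
  (#|double_cosets H U| <= #|[set: gT] : H|%g)%N.
Proof.
rewrite -(leq_pmul2r (cardG_gt0 H)) -(leq_pmul2r (cardG_gt0 U)).
rewrite -mulnA -sum_card_conj_cap [X in (_ <= X * _)%N]mulnC Lagrange ?subsetT //.
rewrite cardsT -sum_nat_const leq_sum // => g _.
by rewrite subset_leq_card ?subsetIl.
Qed.

(** * Unipotent and congruence subgroups *)

Section Unipotents.
Variables (A : finComNzRingType) (H : {group SL2 A}).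
Implicit Type x : A.

Lemma unipD x y : unip (x + y) = (unip x * unip y)%g :> SL2 A.
Proof.
have [[x00 x01 x10 x11] [y00 y01 y10 y11]] := (unipE x, unipE y).
have [s00 s01 s10 s11] := unipE (x + y).
apply: (@SL2_eqP A); rewrite SL2_mulE !(x00, x01, x10, x11, y00, y01, y10, y11, s00, s01, s10, s11);
  by ring.
Qed.

Lemma unipMn x m : unip (x *+ m) = (unip x ^+ m)%g :> SL2 A.
Proof.
elim: m => [|m IHm]; last by rewrite mulrS unipD IHm expgS.
have [s00 s01 s10 s11] := unipE (0 : A).
by apply: (@SL2_eqP A); rewrite !SL2_oneE.
Qed.

Lemma unipotent_abelian : abelian (unipotent A).
Proof.
apply/centsP=> _ /imsetP[x _ ->] _ /imsetP[y _ ->].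
by rewrite /commute -!unipD addrC.
Qed.

(** The unipotent group is abelian, so its subgroup [U :&: H :^ g] contains all
    powers of exponent equal to its index, and taking the m-th power multiplies
    the parameter by m. *)
Lemma index_cap_unipotent a g :
  a \in multiples (#|unipotent A : H :^ g|%g%:R) -> contains_unip H a g.
Proof.
case/multiplesP=> b ->; apply/forallP=> y; rewrite -mulrA mulr_natl unipMn.
set U := unipotent A.
have Uby: unip (b * y) \in U by apply: imset_f.
have nUH : (U \subset 'N(U :&: (H :^ g)))%g.
  by rewrite sub_abelian_norm ?unipotent_abelian ?subsetIl.
rewrite -indexgI.
suff: (unip (b * y)%R ^+ #|U : U :&: (H :^ g)| \in U :&: (H :^ g))%g by case/setIP.
have Nby := subsetP nUH _ Uby.
apply: coset_idr; first by rewrite groupX.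
by rewrite morphX // -card_quotient // expg_cardG // mem_quotient.
Qed.

Fact lower_subproof (x : A) : \det (unip x)^T == 1.
Proof. by rewrite det_tr SL2_det. Qed.

Definition lower x : SL2 A := MkSL2 (lower_subproof x).

Definition Gamma0 (a : A) : {set SL2 A} := [set g : SL2 A | g 1 0 \in multiples a].

Lemma multiples_idealr (a : A) : [/\ 0 \in multiples a,
  {in multiples a &, forall x y, (x + y)%R \in multiples a} &
  forall b, {in multiples a, forall x, (b * x)%R \in multiples a}].
Proof.
split=> [|_ _ /multiplesP[x ->] /multiplesP[y ->]|b _ /multiplesP[x ->]]; apply/multiplesP.
- by exists 0; rewrite mulr0.
- by exists (x + y); rewrite mulrDr.
by exists (b * x); rewrite mulrCA.
Qed.

Lemma Gamma0_group_set a : group_set (Gamma0 a).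
Proof.
have [a0 aD aM] := multiples_idealr a.
apply/group_setP; split=> [|g h]; rewrite !inE; first by rewrite SL2_oneE.
by move=> ag ah; rewrite SL2_mulE aD //; [rewrite mulrC|]; apply: aM.
Qed.
Canonical Gamma0_group a := Group (Gamma0_group_set a).

(** Lower unipotent matrices whose parameters are incongruent modulo [a] lie in
    distinct cosets of [Gamma0 a]. *)
Lemma index_Gamma0_ge a (D : finType) (f : D -> A) :
    (forall i j, f i - f j \in multiples a -> i = j) ->
  (#|D| <= #|[set: SL2 A] : Gamma0 a|%g)%N.
Proof.
move=> f_inj; pose F i := (Gamma0 a :* lower (f i))%g.
rewrite -(card_codom (f := F)) => [|i j].
  apply: subset_leq_card; apply/subsetP=> _ /codomP[i ->].
  by apply/rcosetsP; exists (lower (f i)).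
move/rcoset_eqP; rewrite mem_rcoset inE SL2_mulE.
have [i00 _ i10 _] := SL2_invE (lower (f j)).
have low x : [/\ lower x 1 0 = x & lower x 1 1 = 1].
  by have [_ x01 _ x11] := unipE x; split; rewrite [LHS]mxE.
have [[si ti] [sj tj]] := (low (f i), low (f j)).
by rewrite i00 i10 si ti sj tj mulr1 mul1r => /f_inj.
Qed.

End Unipotents.
Arguments Gamma0 {A} a%_R.

(** * Conjugates of the unipotent group that meet a subgroup in large sets *)

(** In this section [A] stands for O/p^e, [pi] for a generator of its maximal
    ideal and [q] for the order of its residue field; [dichotomy] expresses
    that [A] is a chain ring, without mention of units.  The matrix [h], congruent to 1 modulo [pi ^+ (T + 3 * s)] and outside [H],
    carries the exactness of the level. *)
Section Equidistribution.
Variables (A : finComNzRingType) (pi : A) (H : {group SL2 A}) (T s q : nat).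

Hypothesis dichotomy :
  forall x : A, x \in multiples (pi ^+ s.+1) \/ pi ^+ s \in multiples x.
Hypothesis digits : exists2 D : finType, #|D| = (q ^ s.+1)%N &
  exists f : D -> A, forall i j, f i - f j \in multiples (pi ^+ s.+1) -> i = j.
Hypothesis pi2T0 : pi ^+ T * pi ^+ T = 0.
Variable h : SL2 A.
Hypothesis notHh : h \notin H.
Hypothesis h1 : [/\ h 0 0 - 1 \in multiples (pi ^+ T * pi ^+ (3 * s)),
  h 0 1 \in multiples (pi ^+ T * pi ^+ (3 * s)),
  h 1 0 \in multiples (pi ^+ T * pi ^+ (3 * s)) &
  h 1 1 - 1 \in multiples (pi ^+ T * pi ^+ (3 * s))].

(** If the columns of three good elements were pairwise distinct modulo
    [pi ^+ s.+1], their pairwise determinants would divide [pi ^+ s] and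
    [mem_three_conjugates] would put [h] in [H].  So two cosets of
    [Gamma0 (pi ^+ s.+1)] contain all good elements. *)
Lemma card_contains_unip_le :
  (q ^ s.+1 * #|[set g | contains_unip H (pi ^+ T) g]| <= 2 * #|[set: SL2 A]|)%N.
Proof.
set X := [set g | _].
have [D <- [f f_inj]] := digits.
have le_idx := index_Gamma0_ge f_inj.
suff leX: (#|X| <= 2 * #|Gamma0 (pi ^+ s.+1)|)%N.
  rewrite -(Lagrange (subsetT (Gamma0_group (pi ^+ s.+1)))) mulnA.
  by rewrite [leqRHS]mulnC; apply: leq_mul.
have [-> | [g1 Xg1]] := set_0Vmem X; first by rewrite cards0.
have [|] := boolP (X \subset (g1 *: Gamma0 (pi ^+ s.+1))%g).
  move/subset_leq_card/leq_trans; apply.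
  by rewrite card_lcoset leq_pmull.
case/subsetPn=> g2 Xg2 g12; set c1 := (g1 *: _)%g in g12.
pose c2 := (g2 *: Gamma0 (pi ^+ s.+1))%g.
have leU: (#|c1 :|: c2| <= 2 * #|Gamma0 (pi ^+ s.+1)|)%N.
  by rewrite (leq_trans (leq_card_setU _ _)) // !card_lcoset mul2n addnn.
apply: leq_trans leU; apply: subset_leq_card; apply/subsetP=> g3 Xg3.
apply: contraNT notHh; rewrite inE negb_or => /andP[g13 g23].
have sep g g' : g' \notin (g *: Gamma0 (pi ^+ s.+1))%g ->
    exists y, pi ^+ s = (g 0 0 * g' 1 0 - g' 0 0 * g 1 0) * y.
  rewrite mem_lcoset inE SL2_mulE; have [_ _ -> ->] := SL2_invE g.
  have -> : - g 1 0 * g' 0 0 + g 0 0 * g' 1 0 = g 0 0 * g' 1 0 - g' 0 0 * g 1 0 by ring.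
  by case: (dichotomy (g 0 0 * g' 1 0 - g' 0 0 * g 1 0)) => [-> // | /multiplesP].
have [[y12 d12] [y13 d13] [y23 d23]] := And3 (sep _ _ g12) (sep _ _ g13) (sep _ _ g23).
case: h1 => h00 h01 h10 h11; rewrite !inE in Xg1 Xg2 Xg3.
apply: (mem_three_conjugates pi2T0 Xg1 Xg2 Xg3) h00 h01 h10 h11.
apply/multiplesP; exists (y12 * y13 * y23); rewrite mulnC exprM exprS expr2.
by rewrite {1}d12 {1}d13 {1}d23; ring.
Qed.

Variables (R : realType) (n : nat).
Hypotheses (n_gt0 : (0 < n)%N) (q_gt1 : (1 < q)%N).
Hypothesis rank_le : forall m : nat, (0 < m)%N ->
  (q ^ T.+1 <= m ^ n)%N \/ pi ^+ T \in multiples m%:R.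

(** The index [m] of [U :&: H :^ g] in [U] cannot have [pi ^+ T] among its
    multiples, by [index_cap_unipotent], so [m ^ n] is large. *)
Lemma card_cap_unipotent_le g : ~~ contains_unip H (pi ^+ T) g ->
  #|unipotent A :&: (H :^ g)%g|%:R
    <= #|unipotent A|%:R * q%:R `^ (- T.+1%:R / n%:R) :> R.
Proof.
move=> bad_g; set m := #|unipotent A : H :^ g|%g.
have m_gt0: (0 < m)%N := indexg_gt0 _ _.
case: (rank_le m_gt0) => [le_qm | /index_cap_unipotent good_g]; last by rewrite good_g in bad_g.
rewrite -(LagrangeI (unipotent_group A) (H :^ g)) -/m natrM -mulrA ler_peMr //.
have q_gt0: 0 < q%:R :> R by rewrite ltr0n ltnW.
rewrite mulNr powRN -ler_pdivrMr ?invr_gt0 ?powR_gt0 // mul1r invrK.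
have ->: m%:R = (m%:R ^+ n : R) `^ n%:R^-1.
  by rewrite -powR_mulrn // -powRrM mulfV ?powRr1 // pnatr_eq0 -lt0n.
rewrite powRrM powR_mulrn ?(ltW q_gt0) // -!natrX.
by apply: ge0_ler_powR; rewrite ?invr_ge0 ?nnegrE ?ler_nat.
Qed.

Lemma double_coset_ratio_le :
  #|double_cosets H (unipotent A)|%:R / #|[set: SL2 A] : H|%g%:R
    <= q%:R `^ (- T.+1%:R / n%:R) + 2 * q%:R `^ (- s.+1%:R) :> R.
Proof.
set X := [set g | contains_unip H (pi ^+ T) g]; set U := unipotent_group A.
set b := _ `^ (_ / _); set G := [set: SL2 A].
have q_gt0: 0 < q%:R :> R by rewrite ltr0n ltnW.
have U_gt0: 0 < #|U|%:R :> R by rewrite ltr0n cardG_gt0.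
have H_gt0: 0 < #|H|%:R :> R by rewrite ltr0n cardG_gt0.
have G_gt0: 0 < #|G|%:R :> R by rewrite ltr0n (cardG_gt0 [group of G]).
have iG_gt0: 0 < #|G : H|%g%:R :> R by rewrite ltr0n indexg_gt0.
rewrite ler_pdivrMr // -(ler_pM2r (mulr_gt0 H_gt0 U_gt0)) -!natrM -sum_card_conj_cap.
have -> : (b + 2 * q%:R `^ (- s.+1%:R)) * #|G : H|%g%:R * (#|H| * #|U|)%:R
    = (#|G|%:R * b + #|G|%:R * (2 * q%:R `^ (- s.+1%:R))) * #|U|%:R.
  rewrite -(Lagrange (subsetT H)) !natrM; by ring.
rewrite (bigID [in X]) /= addnC natrD mulrDl; apply: lerD.
  rewrite natr_sum (@le_trans _ _ (\sum_(g | g \notin X) (#|U|%:R * b))) //.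
    by apply: ler_sum => g; rewrite inE; apply: card_cap_unipotent_le.
  rewrite sumr_const -[_ *+ _]mulr_natl mulrCA mulrC ler_wpM2r // ler_wpM2r ?powR_ge0 //.
  by rewrite ler_nat cardsT max_card.
have leX := card_contains_unip_le; rewrite -/X -/G in leX.
rewrite (@le_trans _ _ (#|X|%:R * #|U|%:R)) //.
  rewrite -natrM ler_nat -sum_nat_const leq_sum // => g _.
  by rewrite subset_leq_card ?subsetIl.
rewrite ler_wpM2r // powRN powR_mulrn ?(ltW q_gt0) // mulrA.
rewrite ler_pdivlMr ?exprn_gt0 // -natrX -!natrM ler_nat.
by rewrite mulnC (leq_trans leX) // mulnC.
Qed.

End Equidistribution.

(** * The residue rings modulo powers of a prime *)

Section Residues.
Variables (K : fieldExtType rat) (p : nz_prime_idealr 'O_K) (w u : 'O_K) (k : nat).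
Hypothesis wu : uniformizing p w u.
Local Notation A := {ideal_quot (ideal_exp p k.+1)}.
Local Notation pr := \pi_{ideal_quot (ideal_exp p k.+1)}.

Lemma pr_eqP x y : pr x = pr y <-> x - y \in ideal_exp p k.+1.
Proof. by rewrite Quotient.idealrBE; split=> [->|/eqP]. Qed.

Lemma multiples_pr j x :
  x \in ideal_exp p j -> pr x \in multiples (pr w ^+ j).
Proof.
case/(mem_ideal_exp_multiple wu k.+1)=> y /pr_eqP eq_xy.
by apply/multiplesP; exists (pr y); rewrite -rmorphXn -rmorphM mulrC.
Qed.

Lemma multiples_pr_dichotomy j (x : A) :
  x \in multiples (pr w ^+ j.+1) \/ pr w ^+ j \in multiples x.
Proof.
elim/quotW: x => x; have [/multiples_pr|] := boolP (x \in ideal_exp p j.+1); first by left.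
case/(notin_ideal_exp_divides wu k.+1) => y /pr_eqP eq_y; right.
by apply/multiplesP; exists (pr y); rewrite -rmorphXn -rmorphM mulrC.
Qed.

Lemma mem_ideal_exp_pr j x : (j <= k.+1)%N ->
  pr x \in multiples (pr w ^+ j) -> x \in ideal_exp p j.
Proof.
move=> le_jk /multiplesP[y]; rewrite -[y]reprK -rmorphXn -rmorphM => /pr_eqP.
move/(ideal_exp_sub le_jk) => p_x.
have [pj0 pjD] := ideal_exp_closed p j.
have pw: w ^+ j \in ideal_exp p j.
  by apply/(mem_ideal_expP wu); exists (u ^+ j); rewrite mulrC.
rewrite -[x](subrK (w ^+ j * repr y)) -[x - _]mul1r pjD //.
by rewrite mulrC -[_ * _]addr0 pjD.
Qed.

Lemma multiples_digits j : (j <= k.+1)%N ->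
  exists2 D : finType, #|D| = (#|{: {ideal_quot p}}| ^ j)%N &
  exists f : D -> A, forall i i', f i - f i' \in multiples (pr w ^+ j) -> i = i'.
Proof.
move=> le_jk; exists (j.-tuple {ideal_quot p}); first by rewrite card_tuple.
exists (fun t : j.-tuple _ => pr (digit_expansion w t)) => t t'.
rewrite -rmorphB => /(mem_ideal_exp_pr le_jk) p_tt.
by apply: val_inj; apply: (digit_expansion_inj wu); rewrite !size_tuple.
Qed.

(** When [m] lies in [p ^ j.+1], the [q ^ j.+1] digit expansions are incongruent
    modulo [m], and there are at most [m ^ \dim K] such elements. *)
Lemma card_residue_exp_le j m : (0 < m)%N ->
  (#|{: {ideal_quot p}}| ^ j.+1 <= m ^ \dim {:K})%N \/ pr w ^+ j \in multiples (m%:R : A).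
Proof.
move=> m_gt0; have [pm|] := boolP ((m%:R : 'O_K) \in ideal_exp p j.+1); last first.
  case/(notin_ideal_exp_divides wu k.+1) => y /pr_eqP eq_y; right.
  by apply/multiplesP; exists (pr y); rewrite -rmorphXn -(rmorph_nat pr) -rmorphM mulrC.
left; rewrite -card_tuple.
apply: (card_incongruent_le (x := fun t : j.+1.-tuple _ => digit_expansion w t)) => // t t' z.
move=> eq_z; apply: val_inj; apply: (digit_expansion_inj wu); rewrite !size_tuple // eq_z.
have [pj0 pjD] := ideal_exp_closed p j.+1.
by rewrite -mulr_natr -[_ * _]addr0 pjD.
Qed.

End Residues.

(** If [x] and [y] have the same image under [f] while [y] lies in [H] and [x] does
    not, then [x * y^-1] is outside [H] and congruent to 1 modulo the kernel. *)
Lemma SL2_map_witness (A B : finComNzRingType) (f : {rmorphism A -> B})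
    (H : {group SL2 A}) :
    (H : {set _}) <> SL2_map f @^-1: (SL2_map f @: H) ->
  exists2 h, h \notin H &
    [/\ f (h 0 0 - 1) = 0, f (h 0 1) = 0, f (h 1 0) = 0 & f (h 1 1 - 1) = 0].
Proof.
move=> /eqP; rewrite eqEsubset negb_and => /orP[/subsetPn[x Hx]|].
  by rewrite inE imset_f.
case/subsetPn=> x; rewrite inE => /imsetP[y Hy eq_f] notHx.
have eq_xy i j : f (x i j) = f (y i j).
  have E g : SL2_map f g i j = f (g i j) by rewrite [LHS]mxE.
  by rewrite -!E eq_f.
have f_h i j : f ((x * y^-1)%g i j) = (i == j)%:R.
  rewrite SL2_mulE rmorphD !rmorphM !eq_xy -!rmorphM -rmorphD -SL2_mulE mulgV.
  by rewrite SL2_oneE rmorph_nat.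
exists (x * y^-1)%g; first by rewrite groupMr ?groupV.
by split; rewrite ?rmorphB f_h ?rmorph1 ?subrr.
Qed.

Lemma exact_level_witness (K : fieldExtType rat) (p : nz_prime_idealr 'O_K) w u k
    (H : {group SL2 {ideal_quot (ideal_exp p k.+2)}})
    (pik := \pi_{ideal_quot (ideal_exp p k.+2)} w ^+ k.+1) :
    uniformizing p w u -> exact_level H ->
  exists2 h, h \notin H & [/\ h 0 0 - 1 \in multiples pik,
    h 0 1 \in multiples pik, h 1 0 \in multiples pik & h 1 1 - 1 \in multiples pik].
Proof.
move=> wu /SL2_map_witness[h notHh h1]; exists h => //.
have red0 z : reduction (@ideal_exp_sub _ p k.+1 k.+2 (leqnSn k : (k < k.+2)%N)) z = 0 ->
    z \in multiples pik.
  elim/quotW: z => z; rewrite reduction_pi -(rmorph0 \pi) => /eqP.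
  by rewrite -Quotient.idealrBE subr0 => /(multiples_pr k.+1 wu).
by case: h1 => h00 h01 h10 h11; split; apply: red0.
Qed.

(** * The bound *)

Lemma powR_sum_le (R : realType) (q k T s n : nat) (alpha := (6 * n.+1%:R)^-1 : R) :
    (1 < q)%N -> (0 < n)%N -> (k.+1 <= 2 * T)%N -> (k <= 6 * s.+1)%N ->
  q%:R `^ (- T.+1%:R / n%:R) + 2 * q%:R `^ (- s.+1%:R)
    <= (q%:R : R) `^ (3 - alpha * k.+1%:R).
Proof.
move=> q_gt1 n_gt0 kT ks; set e : R := k.+1%:R.
have q1: 1 <= q%:R :> R by rewrite ler1n ltnW.
have n0: 0 < n%:R :> R by rewrite ltr0n.
have e0: 0 <= e by rewrite ler0n.
have alpha_n: alpha <= (2 * n%:R)^-1.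
  rewrite lef_pV2 ?posrE ?mulr_gt0 ?ltr0n // -!natrM ler_nat; lia.
have alpha6: alpha <= 6^-1.
  rewrite lef_pV2 ?posrE ?mulr_gt0 ?ltr0n // -[leLHS]mulr1 ler_pM2l ?ltr0n // ler1n //.
have b1: q%:R `^ (- T.+1%:R / n%:R) <= q%:R `^ (1 - alpha * e) :> R.
  apply: ler_powR => //.
  have: (2 * n%:R)^-1 * e <= T.+1%:R / n%:R.
    rewrite invfM mulrAC ler_wpM2r ?invr_ge0 ?ler0n // mulrC ler_pdivrMr ?ltr0n //.
    by rewrite -natrM ler_nat; lia.
  have := ler_wpM2r e0 alpha_n; rewrite mulNr; lra.
have b2: q%:R `^ (- s.+1%:R) <= q%:R `^ (1 - alpha * e) :> R.
  apply: ler_powR => //.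
  have: 6^-1 * e <= s.+1%:R + 1.
    by rewrite mulrC ler_pdivrMr ?ltr0n // natr1 -natrM ler_nat; lia.
  have := ler_wpM2r e0 alpha6; lra.
have ->: 3 - alpha * e = 2 + (1 - alpha * e) by ring.
rewrite powRD; last by rewrite pnatr_eq0 -lt0n (ltnW q_gt1) implybT.
set x := _ `^ (1 - _) in b1 b2 *; have x0: 0 <= x by apply: powR_ge0.
have q2: 3 <= q%:R `^ 2 :> R.
  by rewrite powR_mulrn ?ler0n // -natrX ler_nat; nia.
by have := ler_wpM2r x0 q2; lra.
Qed.

Theorem theorem2 (R : realType) (n : nat) :
  exists B alpha : R, [/\ 0 < B, 0 < alpha &
    forall (K : fieldExtType rat), \dim {:K} = n ->
    forall (p : nz_prime_idealr 'O_K) (k : nat)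
      (H : {group SL2 {ideal_quot (ideal_exp p k.+1)}}),
      exact_level H ->
      #|double_cosets H (unipotent {ideal_quot (ideal_exp p k.+1)})|%:R
        / #|[set: SL2 {ideal_quot (ideal_exp p k.+1)}] : H|%g%:R
      <= (#|{: {ideal_quot p}}|%:R : R) `^ (B - alpha * k.+1%:R)].
Proof.
exists 3, (6 * n.+1%:R)^-1; split=> [//||K dimK p k H]; first by rewrite invr_gt0 mulr_gt0 ?ltr0n.
have q_gt1: (1 < #|{: {ideal_quot p}}|)%N.
  by apply/card_gt1P; exists 0, 1; split; rewrite // eq_sym oner_neq0.
have n_gt0: (0 < n)%N by rewrite -dimK adim_gt0.
have [w [u wu]] := local_uniformizer p.
case: k H => [|k] H level_H.
  (* At level one, the exponent is nonnegative and the ratio is at most 1. *)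
  apply: (@le_trans _ _ 1).
    rewrite ler_pdivrMr ?ltr0n ?indexg_gt0 // mul1r ler_nat.
    exact: (card_double_cosets_le H (unipotent_group _)).
  rewrite -[leLHS](powRr0 #|{: {ideal_quot p}}|%:R) ler_powR ?ler1n ?(ltnW q_gt1) //.
  rewrite mulr1 subr_ge0 (@le_trans _ _ 1) ?ler1n // invf_le1 ?mulr_gt0 ?ltr0n //.
  by rewrite -natrM ler1n.
have [h notHh h1] := exact_level_witness wu level_H.
(* The least [T] for which [pi2T0] holds, and then the largest [s] for which
   [piw ^+ (T + 3 * s)] divides the entries of [h - 1]. *)
pose T := (k.+3)./2; pose s := ((k.+1 - T) %/ 3)%N.
have le_k2T: (k.+2 <= 2 * T)%N by rewrite /T; lia.
have le_Tsk: (T + 3 * s <= k.+1)%N by rewrite /s /T; lia.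
have le_ks: (k.+1 <= 6 * s.+1)%N by rewrite /s /T; lia.
set piw := \pi_{ideal_quot (ideal_exp p k.+2)} w in h1.
have piw0: piw ^+ k.+2 = 0.
  rewrite -rmorphXn -[RHS](rmorph0 \pi_{ideal_quot (ideal_exp p k.+2)}).
  apply/(pr_eqP p k.+1 (w ^+ k.+2) 0).
  by rewrite subr0; apply/(mem_ideal_expP wu); exists (u ^+ k.+2); rewrite mulrC.
have pi2T0 : piw ^+ T * piw ^+ T = 0.
  by rewrite -exprD addnn -mul2n -(subnK le_k2T) exprD piw0 mulr0.
have widen x : x \in multiples (piw ^+ k.+1) -> x \in multiples (piw ^+ T * piw ^+ (3 * s)).
  case/multiplesP=> y ->; apply/multiplesP; exists (piw ^+ (k.+1 - (T + 3 * s)) * y).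
  by rewrite mulrA -!exprD subnKC.
apply: le_trans (powR_sum_le R q_gt1 n_gt0 le_k2T le_ks).
apply: (@double_coset_ratio_le _ piw H T s _ (multiples_pr_dichotomy wu s) _ pi2T0 h notHh).
- by apply: (multiples_digits wu); rewrite ltnS; lia.
- by case: h1 => h00 h01 h10 h11; split; apply: widen.
- exact: n_gt0.
- exact: q_gt1.
by move=> m /(card_residue_exp_le k.+1 wu T); rewrite dimK.
Qed.
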